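(* Let $T$ be a quasilinear operator defined on the space $L^1:=L^1(0,1)$ such that $T$ is of weak type $(1,1)$ and of strong type $(p,p)$ for some $p>1$. Suppose that $G$ is a Banach lattice on $[0,1]$ such that $G\supset L^\infty\cap L^\infty(1/t)$ and the operation $f(t)\mapsto f(\sqrt t)$ is bounded on $G$. Then $T$ is bounded $$T:\ \langle L^1,L^\infty\rangle_G^K\to X_G,$$ where $$\langle L^1,L^\infty\rangle_G^K=\{f:\Vert tf^{\ast\ast}(t)\Vert_G<\infty\},\qquad X_G:=\{f:\Vert tf^{\ast}(t)\Vert_G<\infty\}.$$
   Context: All function spaces are over $[0,1]$ with Lebesgue measure; $f^\ast$ is the non-increasing rearrangement of $|f|$ and $f^{\ast\ast}(t)=\frac1t\int_0^tf^\ast(s)\,ds$. $\Vert f\Vert_{L^\infty(1/t)}=\Vert f(t)/t\Vert_{L^\infty}$. Quasilinear means $|T(f+g)|\le C(|Tf|+|Tg|)$ and $|T(\lambda f)|=|\lambda||Tf|$ a.e. for scalars $\lambda$. Weak type $(1,1)$ means $T:L^1\to L^{1,\infty}$ boundedly, where $\Vert f\Vert_{L^{1,\infty}}=\sup_{0<t\le1}tf^\ast(t)$; strong type $(p,p)$ means $T:L^p\to L^p$ boundedly. Boundedness of $T:\langle L^1,L^\infty\rangle_G^K\to X_G$ means $\Vert t(Tf)^\ast(t)\Vert_G\le C\Vert tf^{\ast\ast}(t)\Vert_G$. Here $\langle L^1,L^\infty\rangle_G^K$ is the space of $f\in L^1$ with $\Vert K(t,f;L^1,L^\infty)\Vert_G<\infty$,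 with $K(t,f;L^1,L^\infty)=\inf\{\Vert f_0\Vert_{L^1}+t\Vert f_1\Vert_{L^\infty}:f=f_0+f_1\}=tf^{\ast\ast}(t)$. *)

(* Defs.v *)
From HB Require Import structures.
From mathcomp Require Import all_boot all_order all_algebra.
From mathcomp Require Import all_classical all_reals all_analysis.

Set Implicit Arguments.
Unset Strict Implicit.
Unset Printing Implicit Defensive.

Import Order.TTheory GRing.Theory Num.Theory.
Import numFieldNormedType.Exports.

Local Open Scope classical_set_scope.
Local Open Scope ring_scope.

(* A measurable function on [0, 1] is represented by a Borel function on R;
   the measure [mu01] ignores everything outside [0, 1], and all the notions
   below only depend on classes modulo [mu01]-a.e. equality. *)
Definition mu01 (R : realType) : {measure set (measurableTypeR R) -> \bar R} :=
  mrestr (@lebesgue_measure R) (measurable_itv `[0%R, 1%R]).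

Section rearrangement.
Context (R : realType).
Implicit Types (f : R -> R) (t : R).
Local Open Scope ereal_scope.

(* [y] ranges over \bar R, so the infimum is +oo when no finite level works;
   for a real-valued measurable [f] this does not happen if 0 < t. *)
Definition rearr f t : \bar R :=
  ereal_inf [set y | 0 <= y /\ mu01 R [set x | y < `|f x|%:E] <= t%:E].

Definition rearr_avg f t : \bar R :=
  (t^-1)%:E * \int[mu01 R]_(s in `[0%R, t]) rearr f s.

Definition t_rearr f t : \bar R := t%:E * rearr f t.

Definition t_rearr_avg f t : \bar R := t%:E * rearr_avg f t.

Definition weakL1_norm f : \bar R :=
  ereal_sup [set t_rearr f t | t in `]0%R, 1%R]].

End rearrangement.

(* Banach lattice (ideal space) of measurable functions on [0, 1];
   [bl_norm] is only meaningful on [bl_set]. *)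
Record banach_lattice (R : realType) := BanachLattice {
  bl_set : set (R -> R) ;
  bl_norm : (R -> R) -> R ;
  bl_measurable : forall f : R -> R, bl_set f ->
    measurable_fun [set: measurableTypeR R] f ;
  bl_set0 : bl_set (cst 0) ;
  bl_setD : forall f g, bl_set f -> bl_set g -> bl_set (f \+ g) ;
  bl_setZ : forall (l : R) f, bl_set f -> bl_set (fun x => l * f x) ;
  bl_normD : forall f g, bl_set f -> bl_set g ->
    bl_norm (f \+ g) <= bl_norm f + bl_norm g ;
  bl_normZ : forall (l : R) f, bl_set f ->
    bl_norm (fun x => l * f x) = `|l| * bl_norm f ;
  bl_norm_eq0 : forall f : R -> R, bl_set f -> bl_norm f = 0 ->
    \forall x \ae mu01 R, f x = 0 ;
  (* also yields compatibility with a.e. equality *)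
  bl_solid : forall f g : R -> R, measurable_fun [set: measurableTypeR R] f ->
    bl_set g -> (\forall x \ae mu01 R, `|f x| <= `|g x|) ->
    bl_set f /\ bl_norm f <= bl_norm g ;
  bl_complete : forall u : nat -> R -> R, (forall n, bl_set (u n)) ->
    (forall e : R, 0 < e -> exists N : nat, forall m n : nat,
      (N <= m)%N -> (N <= n)%N -> bl_norm (u m \- u n) < e) ->
    exists2 g, bl_set g & (fun n => bl_norm (u n \- g)) @ \oo --> (0 : R)
}.

Section spaces.
Context (R : realType) (G : banach_lattice R).
Local Open Scope ereal_scope.

(* The norm of G extended by +oo to the functions that do not (up to a null
   set on which they may be infinite) belong to G. *)
Definition bl_enorm (h : R -> \bar R) : \bar R :=
  if `[< (\forall t \ae mu01 R, h t \is a fin_num) /\ bl_set G (fine \o h) >]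
  then (bl_norm G (fine \o h))%:E else +oo.

(* the space <L^1, L^oo>_G^K, using K(t, f; L^1, L^oo) = t f^**(t) *)
Definition Kspace : set (R -> R) :=
  [set f | f \in Lfun (mu01 R) 1 /\ bl_enorm (t_rearr_avg f) < +oo].

Definition Xspace : set (R -> R) :=
  [set f | measurable_fun [set: measurableTypeR R] f /\
           bl_enorm (t_rearr f) < +oo].

(* L^oo /\ L^oo(1/t) is contained in G *)
Definition bl_contains_weighted_Linfty := forall f : R -> R,
  f \in Lfun (mu01 R) +oo ->
  (fun t => f t / t)%R \in Lfun (mu01 R) +oo -> bl_set G f.

Definition bl_sqrt_bounded := exists C : R, forall g : R -> R,
  bl_set G g -> bl_set G (g \o Num.sqrt) /\
  (bl_norm G (g \o Num.sqrt) <= C * bl_norm G g)%R.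

End spaces.

Section operators.
Context (R : realType) (T : (R -> R) -> R -> R).
Local Open Scope ereal_scope.

(* T maps L^1 to classes of measurable functions *)
Definition operator_on_L1 :=
  (forall f : R -> R, f \in Lfun (mu01 R) 1 ->
     measurable_fun [set: measurableTypeR R] (T f)) /\
  (forall f g : R -> R, f \in Lfun (mu01 R) 1 -> g \in Lfun (mu01 R) 1 ->
     (\forall x \ae mu01 R, f x = g x) ->
     \forall x \ae mu01 R, T f x = T g x).

Definition quasilinear_on_L1 :=
  (exists C : R, forall f g : R -> R,
     f \in Lfun (mu01 R) 1 -> g \in Lfun (mu01 R) 1 ->
     \forall x \ae mu01 R,
       (`|T (f \+ g)%R x| <= C * (`|T f x| + `|T g x|))%R) /\
  (forall (l : R) (f : R -> R), f \in Lfun (mu01 R) 1 ->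
     \forall x \ae mu01 R,
       (`|T (fun y => l * f y) x| = `|l| * `|T f x|)%R).

Definition weak_type_11 := exists C : R, forall f : R -> R,
  f \in Lfun (mu01 R) 1 ->
  weakL1_norm (T f) <= C%:E * 'N[mu01 R]_1[EFin \o f].

Definition strong_type (p : \bar R) := exists C : R, forall f : R -> R,
  f \in Lfun (mu01 R) p ->
  T f \in Lfun (mu01 R) p /\
  'N[mu01 R]_p[EFin \o T f] <= C%:E * 'N[mu01 R]_p[EFin \o f].

Definition bounded_Kspace_Xspace (G : banach_lattice R) :=
  exists C : R, forall f, Kspace G f ->
    Xspace G (T f) /\
    bl_enorm G (t_rearr (T f)) <= C%:E * bl_enorm G (t_rearr_avg f).

End operators.

(* Main.v *)
(* Fix t in (0, 1] and let s be the n-fold iterated square root of t, with n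
   chosen so that t^(1 - 1/p) <= s. Put K(s) = s f**(s) and split f at the
   level l = K(s) / s >= f*(s). The part of f above l is carried by a set of
   measure at most s, so its L^1 norm is at most K(s); the part below l is
   bounded by l, so its L^p norm is at most K(s) / s. The weak type (1, 1) bound
   on the first part and the strong type (p, p) bound on the second give
   t (Tf)*(t) <= C (K(s) + t^(1 - 1/p) K(s) / s) <= 2 C K(s). Since s is an
   iterated square root of t, the boundedness of g(t) |-> g(sqrt t) on G
   concludes. *)
Require Import Defs.
From HB Require Import structures.
From mathcomp Require Import all_boot all_order all_algebra.
From mathcomp Require Import all_classical all_reals all_analysis.
From mathcomp Require Import measurable_realfun ess_sup_inf ring lra.
Import Order.TTheory GRing.Theory Num.Theory.
Import numFieldNormedType.Exports.
Local Open Scope classical_set_scope.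
Local Open Scope ring_scope.

Set Implicit Arguments.
Unset Strict Implicit.
Unset Printing Implicit Defensive.

(* A copy of [mu01], whose body is an instance of [Measure.type], on which the
   probability structure can be declared. *)
Definition prob01 (R : realType) : set (measurableTypeR R) -> \bar R := mu01 R.

HB.instance Definition _ (R : realType) :=
  Measure.copy (@prob01 R) (mu01 R).

Lemma mu01_setT (R : realType) : mu01 R setT = 1%E.
Proof.
by rewrite /mu01 /= /mrestr setTI lebesgue_measure_itv /= lte_fin ltr01 -EFinD
  subr0.
Qed.

HB.instance Definition _ (R : realType) :=
  Measure_isProbability.Build _ _ _ (@prob01 R) (@mu01_setT R).

(* [measurableTypeR R] and [R] are only convertible, which hides the instance
   of the library from type class resolution. *)
#[local] Instance ae_mu01_filter (R : realType) :
  Filter (nbhs (almost_everywhere (mu01 R))) :=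
  ae_filter_ringOfSetsType (mu01 R).

(** * Distribution functions and rearrangements on the unit interval *)

Section mu01_rearrangement.
Context (R : realType).
Implicit Types (f g h : measurableTypeR R -> R) (s t y : R).
Local Open Scope ereal_scope.

Lemma mu01_itvoo s t : (0 <= s)%R -> (s <= t)%R -> (t <= 1)%R ->
  mu01 R `]s, t[%classic = (t - s)%:E.
Proof.
move=> s0 st t1; rewrite /mu01 /= /mrestr setIidl; last first.
  move=> x /=; rewrite !in_itv/= => /andP[sx xt].
  by rewrite (le_trans s0 (ltW sx)) (le_trans (ltW xt)).
rewrite lebesgue_measure_itv /= lte_fin; case: ltgtP st => // -> _.
by rewrite subrr.
Qed.

Lemma ae_mu01_itvoo : \forall t \ae mu01 R, (0 < t < 1)%R.
Proof.
exists (~` `]0%R, 1%R[%classic); split.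
- exact: measurableC.
- have := @probability_setC _ _ _ (@prob01 R) `]0%R, 1%R[%classic.
  by rewrite /= /prob01 => ->//; rewrite mu01_itvoo ?lexx ?ler01 // subr0 subee.
- by move=> x /= /negP nx; rewrite in_itv/=; exact/negP.
Qed.

Lemma measurable_superlevel f (y : \bar R) : measurable_fun setT f ->
  measurable [set x | y < `|f x|%:E].
Proof.
move=> mf; rewrite -[X in measurable X]setTI.
apply: emeasurable_fun_o_infty => //.
by apply/measurable_EFinP; exact: measurableT_comp.
Qed.

(** Viewing [|f|] as a random variable gives access to the right-continuity of its distribution
    function, to its limit 0 at infinity and to the layer-cake formula. *)
Lemma mu01_ccdf f (mf : measurable_fun setT f) :
  exists X : {RV (@prob01 R) >-> R}, X = Num.norm \o f :> (_ -> _) /\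
    forall y, mu01 R [set x | y%:E < `|f x|%:E] = ccdf X y.
Proof.
have mF : measurable_fun setT (Num.norm \o f) by exact: measurableT_comp.
exists (mfun_Sub (mem_set mF)); split => // y.
rewrite /ccdf /distribution /pushforward; congr (mu01 R _).
by apply/seteqP; split => x /=; rewrite in_itv/= andbT.
Qed.

Lemma rearr_ge0 f t : 0 <= rearr f t.
Proof. by apply: le_ereal_inf_tmp => y []. Qed.

Lemma rearr_nincr f : {homo rearr f : s t / (s <= t)%R >-> t <= s}.
Proof.
move=> s t st; apply: ereal_inf_le_tmp => y [y0 ys]; split => //.
by rewrite (le_trans ys)// lee_fin.
Qed.

(* [rearr f] is the generalized inverse of the distribution function of [f];
   the infimum is attained since the latter is right-continuous. *)
Lemma rearr_leP f t y : measurable_fun setT f -> (0 <= y)%R ->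
  rearr f t <= y%:E <-> mu01 R [set x | y%:E < `|f x|%:E] <= t%:E.
Proof.
move=> mf y0; split => [fty|fyt]; last by apply: ereal_inf_lbound; split.
have [X [_ XE]] := mu01_ccdf mf; rewrite XE.
apply: (cvge_le _ (@ccdf_right_continuous _ _ _ _ X y)).
near=> z.
have yz : (y < z)%R by near: z; exact: nbhs_right_gt.
have : rearr f t < z%:E by rewrite (le_lt_trans fty).
move=> /ereal_inf_lt[w [w0 wt] wz]; rewrite -XE (le_trans _ wt)//.
apply: le_measure; rewrite ?inE; [exact: measurable_superlevel..|].
by move=> x /=; exact: lt_trans.
Unshelve. all: by end_near. Qed.

(** By [rearr_leP], an infinite value would keep the distribution function at least [t] at every
    nonnegative level, although it tends to 0. *)
Lemma rearr_fin_num f t : measurable_fun setT f -> (0 < t)%R ->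
  rearr f t \is a fin_num.
Proof.
move=> mf t0; rewrite ge0_fin_numE ?rearr_ge0//.
have [X [_ XE]] := mu01_ccdf mf.
rewrite ltNge; apply/negP => fty.
suff : t%:E <= 0 by rewrite lee_fin leNgt t0.
apply: (cvge_ge _ (cvg_ccdfy0 X)).
near=> z; rewrite -XE leNgt; apply/negP => /ltW /rearr_leP.
have z0 : (0 <= z)%R by near: z; exact: nbhs_pinfty_ge.
by move=> /(_ mf z0) /(le_trans fty).
Unshelve. all: by end_near. Qed.

(** By monotonicity, preimages of rays are intervals. *)
Lemma measurable_rearr f :
  measurable_fun setT (rearr f : measurableTypeR R -> \bar R).
Proof.
apply: (measurability _ (ErealGenCInfty.measurableE R)) => _ [_ [y ->] <-].
apply: measurableI => //; apply: is_interval_measurable.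
move=> s t /= + + u /andP[su ut].
rewrite !in_itv/= !andbT => fs ft.
by rewrite (le_trans ft)// rearr_nincr.
Qed.

(** Off a null set, [|h| > C * (a + b)] forces [|f| > a] or [|g| > b], and each of these two events
    has measure at most [t / 2]. *)
Lemma rearr_quasilinear (C : R) f g h t a b :
  measurable_fun setT f -> measurable_fun setT g -> measurable_fun setT h ->
  (0 <= C)%R -> (0 <= a)%R -> (0 <= b)%R ->
  (\forall x \ae mu01 R, `|h x| <= C * (`|f x| + `|g x|))%R ->
  rearr f (t / 2) <= a%:E -> rearr g (t / 2) <= b%:E ->
  rearr h t <= (C * (a + b))%:E.
Proof.
move=> mf mg mh C0 a0 b0 hfg /(rearr_leP _ mf a0) fa /(rearr_leP _ mg b0) gb.
apply/rearr_leP => //; first by rewrite mulr_ge0 ?addr_ge0.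
have [N [mN N0 hN]] := hfg.
have -> : t%:E = mu01 R N + ((t / 2)%:E + (t / 2)%:E).
  by rewrite N0 add0e -EFinD -splitr.
apply: le_trans (leeD (lexx _) (leeD fa gb)).
pose A := [set x | a%:E < `|f x|%:E]; pose B := [set x | b%:E < `|g x|%:E].
have mA : measurable A by exact: measurable_superlevel.
have mB : measurable B by exact: measurable_superlevel.
have mAB : measurable (A `|` B) by exact: measurableU.
apply: le_trans (leeD (lexx (mu01 R N)) (measureU2 (mu01 R) mA mB)).
apply: le_trans (measureU2 (mu01 R) mN mAB).
apply: le_measure; rewrite ?inE.
- exact: measurable_superlevel.
- exact: measurableU.
move=> x /=; rewrite lte_fin => hx.
have [Nx|/(contra_not (hN x))/contrapT hCx] := pselect (N x); first by left.
right; rewrite /A /B /= !lte_fin; apply/orP; rewrite !ltNge -negb_and.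
apply: contraTN hx => /andP[fx gx]; rewrite -leNgt (le_trans hCx)//.
by rewrite ler_wpM2l// lerD.
Qed.

Lemma measurable_fine_t_rearr f :
  measurable_fun setT f ->
  measurable_fun setT (fine \o t_rearr f : measurableTypeR R -> R).
Proof.
move=> mf; apply: measurableT_comp; first exact: fine_measurable.
apply: emeasurable_funM; last exact: measurable_rearr.
by apply/measurable_EFinP.
Qed.

(* Hardy-Littlewood, by the layer-cake formula on both sides. *)
Lemma integral_le_rearr f (E : set (measurableTypeR R)) s :
  measurable_fun setT f -> measurable E -> (s <= 1)%R -> mu01 R E <= s%:E ->
  \int[mu01 R]_x `|f x * \1_E x|%:E <= \int[mu01 R]_(u in `[0%R, s]) rearr f u.
Proof.
move=> mf mE s1 Es.
(* The endpoint 0 is left out because the rearrangement may be infinite there; on []0, s[] it is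
   finite, so [fine] loses nothing. *)
pose X := (fun u => fine (rearr f u) * \1_(`]0%R, s[%classic) u)%R.
have mX : measurable_fun setT (X : measurableTypeR R -> R).
  apply: measurable_funM; last exact: measurable_indic.
  apply: measurableT_comp; first exact: fine_measurable.
  exact: measurable_rearr.
have mfE : measurable_fun setT
    ((fun x => f x * \1_E x)%R : measurableTypeR R -> R).
  by apply: measurable_funM => //; exact: measurable_indic.
have X0 u : (0 <= X u)%R by rewrite mulr_ge0// fine_ge0// rearr_ge0.
apply: (@le_trans _ _ (\int[mu01 R]_u (X u)%:E)); last first.
  rewrite [leRHS]integral_mkcond/=; apply: ge0_le_integral => //.
  - by move=> u _; rewrite lee_fin.
  - exact/measurable_EFinP.
  - apply/(measurable_restrictT _ (measurable_itv _)).
    by apply: measurable_funTS; exact: measurable_rearr.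
  - move=> u _; rewrite /X indicE patchE.
    have [/set_mem/=|_] := boolP (u \in _); last first.
      by rewrite mulr0; case: ifP => // _; exact: rearr_ge0.
    rewrite in_itv/= => /andP[u0 us]; rewrite mulr1 mem_set; last first.
      by rewrite /= in_itv/= (ltW u0) ltW.
    by rewrite fineK// rearr_fin_num.
have [Y [YE ccdfE]] := mu01_ccdf mfE.
have [Z [ZE ccdfZ]] := mu01_ccdf mX.
have -> : \int[mu01 R]_x `|f x * \1_E x|%:E = 'E_(@prob01 R)[Y].
  by rewrite expectation_def; apply: eq_integral => x _; rewrite YE.
have -> : \int[mu01 R]_u (X u)%:E = 'E_(@prob01 R)[Z].
  by rewrite expectation_def; apply: eq_integral => u _; rewrite ZE/= ger0_norm.
rewrite !ge0_expectation_ccdf//; [|by move=> x; rewrite ?YE ?ZE /=..].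
apply: ge0_le_integral => //.
- by apply: measurable_funTS; exact: ccdf_measurable.
- by apply: measurable_funTS; exact: ccdf_measurable.
move=> r; rewrite /= in_itv/= andbT => r0.
rewrite -[leLHS]/(ccdf Y r) -[leRHS]/(ccdf Z r) -ccdfE -ccdfZ.
set A := [set x | _ < `|f x * _|%:E].
have mA : measurable A by exact: measurable_superlevel.
have AE : mu01 R A <= mu01 R E.
  apply: le_measure; rewrite ?inE// => x; rewrite /A /= lte_fin indicE.
  by case: (boolP (x \in E)) => [/set_mem//|_]; rewrite mulr0 normr0 ltNge r0.
have Af : mu01 R A <= mu01 R [set x | r%:E < `|f x|%:E].
  apply: le_measure; rewrite ?inE//; first exact: measurable_superlevel.
  move=> x; rewrite /A /= !lte_fin => /lt_le_trans; apply.
  by rewrite normrM ler_piMr// indicE; case: (_ \in _); rewrite ?normr1 ?normr0.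
have mAfin : mu01 R A \is a fin_num by exact: (fin_num_measure (@prob01 R)).
have A0 : (0 <= fine (mu01 R A))%R by rewrite fine_ge0 ?measure_ge0.
have A1 : (fine (mu01 R A) <= 1)%R.
  by rewrite -lee_fin fineK// (le_trans AE)// (le_trans Es).
(* Let m be the measure of [A], bounded by [s] and by the measure of the set where [|f| > r]. It
   suffices that []0, m[] lies in the superlevel set of [X]: for u < m, [rearr f u <= r] would give
   m <= u. *)
rewrite -(fineK mAfin) -[X in X%:E <= _]subr0 -(mu01_itvoo (lexx _) A0 A1).
apply: le_measure; rewrite ?inE.
- exact: measurable_itv.
- exact: measurable_superlevel.
move=> u; rewrite /= in_itv/= => /andP[u0 uA].
have us : (u < s)%R.
  by rewrite (lt_le_trans uA)// -lee_fin fineK// (le_trans AE).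
rewrite /X indicE mem_set ?mulr1/=; last by rewrite in_itv/= u0.
rewrite lte_fin ger0_norm ?fine_ge0 ?rearr_ge0// -lte_fin.
rewrite fineK ?rearr_fin_num//.
rewrite ltNge; apply/negP => /(rearr_leP _ mf r0) /(le_trans Af).
by rewrite -(fineK mAfin) lee_fin leNgt uA.
Qed.

End mu01_rearrangement.

(** * Iterated square roots *)

Lemma iter_sqrt_itv (R : rcfType) n (t : R) : 0 < t <= 1 ->
  t <= iter n Num.sqrt t <= 1.
Proof.
move=> /andP[t0 t1]; elim: n => [|n /andP[tn n1]]; first by rewrite lexx t1.
have n0 : 0 < iter n Num.sqrt t by rewrite (lt_le_trans t0).
rewrite iterS; set s := iter n _ t in tn n1 n0 *; apply/andP; split.
  apply: (le_trans tn); rewrite -{1}(sqr_sqrtr (ltW n0)) expr2.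
  by rewrite ler_piMr ?sqrtr_ge0// -sqrtr1 ler_wsqrtr.
by rewrite -sqrtr1 ler_wsqrtr.
Qed.

Lemma le_iter_sqrt (R : rcfType) n (s t : R) : s <= t ->
  iter n Num.sqrt s <= iter n Num.sqrt t.
Proof. by move=> st; elim: n => //= n; exact: ler_wsqrtr. Qed.

Lemma iter_sqrtK (R : rcfType) n (t : R) : 0 <= t ->
  (iter n Num.sqrt t) ^+ (2 ^ n) = t.
Proof.
move=> t0; elim: n => [|n IH]; first by rewrite expn0 expr1.
rewrite expnS exprM sqr_sqrtr ?IH//.
by case: n {IH} => // n; exact: sqrtr_ge0.
Qed.

(** This is the p-th power of t^(1 - 1/p) <= s for the iterated root s. Since t = s^(2^n), the
    right-hand side is s^(p - 2^n (p - 1)), a nonpositive power of s <= 1. *)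
Lemma powR_iter_sqrt (R : realType) n (p t : R) : p <= 2 ^+ n * (p - 1) ->
  0 < t <= 1 -> 1 <= (iter n Num.sqrt t / t) `^ p * t.
Proof.
move=> np t01; have /andP[t0 _] := t01.
have /andP[ts s1] := iter_sqrt_itv n t01.
have s0 := lt_le_trans t0 ts.
rewrite -{2 3}(iter_sqrtK n (ltW t0)); set s := iter n _ t in ts s1 s0 *.
rewrite -powR_mulrn ?(ltW s0)// -{1}(powRr1 (ltW s0)) -powRN -powRD; last first.
  by rewrite (gt_eqF s0) implybT.
rewrite -powRrM -powRD; last by rewrite (gt_eqF s0) implybT.
rewrite -[leLHS](powRr0 s) ger_powR ?s0// natrX; lra.
Qed.

(** * From norm bounds to pointwise bounds on the rearrangement *)

Section weak_type.
Context (R : realType).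
Local Open Scope ereal_scope.

(** For finite [p], Chebyshev's inequality at the level (s / t) N, with s the iterated root, bounds
    the measure by (t / s)^p, which [powR_iter_sqrt] bounds by [t]. For infinite [p], the norm
    bounds [|g|] almost everywhere and no root is taken. *)
Lemma rearr_le_Lnorm (p : \bar R) : 1 < p -> exists n : nat,
  forall (g : measurableTypeR R -> R) (N t : R), measurable_fun setT g ->
  (0 < t <= 1)%R -> (0 <= N)%R -> 'N[mu01 R]_p[EFin \o g] <= N%:E ->
  rearr g t <= (iter n Num.sqrt t / t * N)%:E.
Proof.
case: p => [p||//]; last first.
  move=> _; exists 0%N => g N t mg /andP[t0 t1] N0 gN.
  rewrite divff ?gt_eqF// mul1r; apply/rearr_leP => //.
  move: gN; rewrite unlock /Lnorm mu01_setT lte01 => /ess_supP.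
  rewrite ae_le_measureP; last first.
    by apply: measurableT_comp => //; exact/measurable_EFinP.
  move=> gN.
  rewrite (_ : [set x | _] = (abse \o (EFin \o g)) @^-1` `]N%:E, +oo[).
    by rewrite gN lee_fin ltW.
  by apply/seteqP; split => x /=; rewrite in_itv/= andbT.
rewrite lte_fin => p1.
have p0 : (0 < p)%R by rewrite (lt_trans ltr01).
have [n np] : exists n, (p <= 2 ^+ n * (p - 1))%R.
  (* Any integer k above p / (p - 1) works, since k < 2^k. *)
  exists (Num.truncn (p / (p - 1))).+1.
  rewrite -ler_pdivrMr ?subr_gt0// (le_trans (ltW (truncnS_gt _)))//.
  by rewrite -natrX ler_nat ltnW// ltn_expl.
exists n => g N t mg t01 N0 gN; have /andP[t0 t1] := t01.
have /andP[ts _] := iter_sqrt_itv n t01.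
have s0 := lt_le_trans t0 ts.
set y := (_ / t)%R; have y0 : (0 < y)%R by rewrite divr_gt0.
apply/rearr_leP => //; first exact: mulr_ge0 (ltW y0) N0.
(* Chebyshev's inequality needs a positive level; for [N = 0] the function vanishes almost
   everywhere. *)
move: N0; rewrite le_eqVlt => /predU1P[N0|N0].
  have : 'N[mu01 R]_p%:E[EFin \o g] = 0.
    by apply/eqP; rewrite eq_le Lnorm_ge0 andbT (le_trans gN)// -N0.
  have mEg : measurable_fun setT (EFin \o g) by exact/measurable_EFinP.
  move=> /(Lnorm_eq0_eq0 mEg); rewrite lte_fin => /(_ p0) g0.
  have : mu01 R [set x | (y * N)%:E < `|g x|%:E] = 0.
    apply: measure_negligible; first exact: measurable_superlevel.
    apply: negligibleS g0 => x /=; rewrite -N0 mulr0 lte_fin normr_gt0.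
    by move=> /eqP + gx; apply; have [] := gx I.
  by move=> ->; rewrite lee_fin ltW.
have yN0 : (0 < y * N)%R by rewrite mulr_gt0.
have mEg : measurable_fun setT (EFin \o g) by exact/measurable_EFinP.
have := @le_integral_comp_abse _ _ _ (mu01 R) setT measurableT (EFin \o g)
  (y * N)%R (fun z : \bar R => z `^ p) (@measurable_poweR R p)
  (fun z _ => poweR_ge0 z p) _ mEg yN0.
rewrite setTI => cheb.
set A := [set x | _].
have mA : measurable A by exact: measurable_superlevel.
have mB : measurable [set x | ((y * N)%:E <= `|(EFin \o g) x|)].
  rewrite -[X in measurable X]setTI; apply: emeasurable_fun_c_infty => //.
  by apply/measurable_EFinP; exact: measurableT_comp.
have AB : mu01 R A <= mu01 R [set x | ((y * N)%:E <= `|(EFin \o g) x|)].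
  by apply: le_measure; rewrite ?inE// => x /= /ltW.
have Np : \int[mu01 R]_x (`|(EFin \o g) x| `^ p) <= (N `^ p)%:E.
  rewrite -poweR_Lnorm ?gt_eqF// -poweR_EFin gt0_ler_poweR ?(ltW p0)//.
  - by rewrite in_itv/= Lnorm_ge0 leey.
  - by rewrite in_itv/= lee_fin (ltW N0) leey.
have {cheb} : ((y * N) `^ p)%:E * mu01 R A <= (N `^ p)%:E.
  rewrite (le_trans _ Np)// (le_trans _ (cheb _))//.
    by rewrite -poweR_EFin; apply: lee_wpmul2l => //; exact: poweR_ge0.
  move=> a b; rewrite !inE/= !in_itv/= !andbT => a0 b0 ab.
  by rewrite gt0_ler_poweR ?(ltW p0)// in_itv/= ?a0 ?b0 leey.
have mAfin : mu01 R A \is a fin_num by exact: (fin_num_measure (@prob01 R)).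
rewrite -(fineK mAfin) -EFinM !lee_fin => cheb.
have k0 : (0 < y `^ p)%R by rewrite powR_gt0.
have kN : (0 < N `^ p)%R by rewrite powR_gt0.
have kt := powR_iter_sqrt np t01; rewrite -/y in kt.
rewrite -(ler_pM2l k0) (le_trans _ kt)//.
move: cheb; rewrite powRM ?(ltW y0) ?(ltW N0)// mulrAC -[leRHS]mul1r.
by rewrite ler_pM2r.
Qed.
End weak_type.

(** * The K-functional t f**(t), and norms of bounded functions *)

Section K_functional.
Context (R : realType).
Implicit Types (f : measurableTypeR R -> R) (s t : R).
Local Open Scope ereal_scope.

Lemma t_rearr_avgE f s : (0 < s)%R ->
  t_rearr_avg f s = \int[mu01 R]_(u in `[0%R, s]) rearr f u.
Proof.
move=> s0; rewrite /t_rearr_avg /rearr_avg muleA -EFinM.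
by rewrite divff ?gt_eqF// mul1e.
Qed.

Lemma t_rearr_avg_ge0 f s : (0 < s)%R -> 0 <= t_rearr_avg f s.
Proof.
by move=> s0; rewrite t_rearr_avgE// integral_ge0// => u _; exact: rearr_ge0.
Qed.

Lemma t_rearr_avg_ndecr f s t : (0 < s)%R -> (s <= t)%R ->
  t_rearr_avg f s <= t_rearr_avg f t.
Proof.
move=> s0 st; rewrite !t_rearr_avgE ?(lt_le_trans s0)//.
apply: ge0_subset_integral => //.
- by apply: measurable_funTS; exact: measurable_rearr.
- by move=> u _; exact: rearr_ge0.
- by apply: subset_itvl; rewrite bnd_simp.
Qed.

Lemma t_rearr_le_avg f s : (0 < s <= 1)%R -> t_rearr f s <= t_rearr_avg f s.
Proof.
move=> /andP[s0 s1]; rewrite t_rearr_avgE// /t_rearr muleC.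
apply: (@le_trans _ _ (rearr f s * mu01 R `[0%R, s]%classic)).
  apply: lee_wpmul2l; first exact: rearr_ge0.
  rewrite -[X in X%:E]subr0 -(mu01_itvoo (lexx _) (ltW s0) s1).
  by apply: le_measure; rewrite ?inE//; exact: subset_itv_oo_cc.
rewrite -integral_cst//; apply: ge0_le_integral => //.
- by move=> u _; exact: rearr_ge0.
- by apply: measurable_funTS; exact: measurable_rearr.
- by move=> u /=; rewrite in_itv/= => /andP[_]; exact: rearr_nincr.
Qed.

(** The total mass is 1, so the constant [M] has norm [M] for every exponent. *)
Lemma Lnorm_le_bound (p : \bar R) f (M : R) : 1 <= p -> measurable_fun setT f ->
  (0 <= M)%R -> (forall x, `|f x| <= M)%R -> 'N[mu01 R]_p[EFin \o f] <= M%:E.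
Proof.
move=> p1 mf M0 fM; case: p p1 => [p| |//]; last first.
  move=> _; rewrite unlock /Lnorm mu01_setT lte01; apply/ess_supP/aeW => x /=.
  by rewrite lee_fin.
rewrite lee_fin => p1; have p0 : (0 < p)%R by rewrite (lt_le_trans ltr01).
have -> : M%:E = (\int[mu01 R]_x (M `^ p)%:E) `^ p^-1.
  rewrite integral_cst//= mu01_setT mule1 poweR_EFin -powRrM mulfV ?gt_eqF//.
  by rewrite powRr1.
rewrite unlock /Lnorm gt0_ler_poweR ?invr_ge0 ?(ltW p0)//.
- by rewrite in_itv/= leey andbT integral_ge0// => x _; exact: poweR_ge0.
- rewrite in_itv/= leey andbT integral_ge0// => x _.
  by rewrite lee_fin powR_ge0.
apply: ge0_le_integral => //.
- by move=> x _; exact: poweR_ge0.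
- apply: (measurableT_comp (measurable_poweR _)) => //.
  by apply: measurableT_comp => //; exact/measurable_EFinP.
- by move=> x _ /=; rewrite lee_fin ge0_ler_powR ?(ltW p0).
Qed.

End K_functional.

(** * Norms and iterated square roots in the lattice *)

Section banach_lattice.
Context (R : realType) (G : banach_lattice R).

(** Solidity compares [g] with 0, whose norm vanishes by homogeneity. *)
Lemma bl_norm_ge0 (g : R -> R) : bl_set G g -> 0 <= bl_norm G g.
Proof.
move=> Gg; have [] := @bl_solid _ G (cst 0) g _ Gg; first exact: measurable_cst.
  by apply: aeW => x; rewrite normr0.
move=> _; rewrite -[X in bl_norm _ X](_ : (fun x => 0 * cst 0 x) = _).
  by rewrite (bl_normZ 0 (bl_set0 G)) normr0 mul0r.
by apply/funext => x; rewrite mul0r.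
Qed.

Lemma bl_iter_sqrt_bounded n : bl_sqrt_bounded G ->
  exists2 C : R, 0 <= C & forall g : R -> R, bl_set G g ->
    bl_set G (g \o iter n Num.sqrt) /\
    bl_norm G (g \o iter n Num.sqrt) <= C * bl_norm G g.
Proof.
move=> [C GC]; elim: n => [|n [D D0 GD]].
  by exists 1 => // g Gg; rewrite mul1r.
(* The sign of [C] is not prescribed; the absolute value makes the bounds multiply. *)
exists (`|C| * D); first by rewrite mulr_ge0.
move=> g /GD[Gg gD]; have [GgS gS] := GC _ Gg.
have -> : g \o iter n.+1 Num.sqrt = (g \o iter n Num.sqrt) \o Num.sqrt.
  by apply/funext => x; rewrite [LHS]/comp iterSr.
split=> //; rewrite (le_trans gS)// -mulrA.
rewrite (@le_trans _ _ (`|C| * bl_norm G (g \o iter n Num.sqrt)))//.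
  by rewrite ler_wpM2r ?ler_norm// bl_norm_ge0.
by rewrite ler_wpM2l.
Qed.

End banach_lattice.

(** * The pointwise estimate by splitting [f] *)

Section main.
Context (R : realType) (T : (R -> R) -> R -> R).
Local Open Scope ereal_scope.

Lemma t_rearr_le_t_rearr_avg_iter_sqrt : operator_on_L1 T ->
  quasilinear_on_L1 T -> weak_type_11 T ->
  (exists2 p : \bar R, 1 < p & strong_type T p) ->
  exists n : nat, exists2 C : R, (0 <= C)%R &
    forall (f : measurableTypeR R -> R) (t : R),
      f \in Lfun (mu01 R) 1 -> (0 < t <= 1)%R ->
      t_rearr_avg f (iter n Num.sqrt t) \is a fin_num ->
      t_rearr (T f) t <= C%:E * t_rearr_avg f (iter n Num.sqrt t).
Proof.
move=> [mT _] [[Q TQ] _] [W TW] [p p1 [S TS]].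
have [n rearrn] := rearr_le_Lnorm p1.
(* [Q] comes from quasilinearity, [W] and [S] from the weak and strong type bounds on the two parts,
   and 2 from evaluating their rearrangements at [t / 2]. *)
exists n, (`|Q| * (2 * (`|W| + `|S|)))%R; first by rewrite !mulr_ge0 ?addr_ge0.
move=> f t fL1 t01; have /andP[t0 t1] := t01.
have /andP[ts s1] := iter_sqrt_itv n t01; set s := iter n _ t in ts s1 *.
have s0 : (0 < s)%R := lt_le_trans t0 ts.
move=> Kfin; have := t_rearr_avg_ge0 f s0; rewrite -(fineK Kfin).
set k := fine (t_rearr_avg f s); rewrite lee_fin => k0.
have mf : measurable_fun setT f by case/andP: fL1; rewrite inE.
pose l := (k / s)%R; have l0 : (0 <= l)%R by rewrite divr_ge0// ltW.
pose E := [set x | l%:E < `|f x|%:E].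
have mE : measurable E by exact: measurable_superlevel.
(* Equivalent to f*(s) <= l, that is, to s f*(s) <= K(s). *)
have Es : mu01 R E <= s%:E.
  apply/(rearr_leP _ mf l0); rewrite -(@lee_pmul2l _ s%:E)// -EFinM.
  rewrite mulrC divfK ?gt_eqF// fineK//.
  by apply: t_rearr_le_avg; rewrite s0.
pose f0 : measurableTypeR R -> R := (fun x => f x * \1_E x)%R.
pose f1 : measurableTypeR R -> R := (fun x => f x * \1_(~` E) x)%R.
have mf0 : measurable_fun setT f0.
  by apply: measurable_funM => //; exact: measurable_indic.
have mf1 : measurable_fun setT f1.
  by apply: measurable_funM => //; apply: measurable_indic; exact: measurableC.
have fE : f = (f0 \+ f1)%R.
  apply/funext => x; rewrite /= /f0 /f1 !indicE in_setC.
  by case: (x \in E); rewrite /= !(mulr0, mulr1) (addr0, add0r).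
have f0k : 'N[mu01 R]_1[EFin \o f0] <= k%:E.
  rewrite Lnorm1 fineK// t_rearr_avgE//.
  exact: (integral_le_rearr mf mE s1 Es).
have f1l x : (`|f1 x| <= l)%R.
  rewrite /f1 indicE in_setC; case: (boolP (x \in E)) => [_|].
    by rewrite mulr0 normr0.
  by rewrite mulr1 notin_setE /E /= lte_fin => /negP; rewrite -leNgt.
have inL (q : \bar R) g (M : R) : measurable_fun setT g ->
    'N[mu01 R]_q[EFin \o g] <= M%:E -> g \in Lfun (mu01 R) q.
  move=> mg gM; apply/andP; split; rewrite inE//=.
  by rewrite /finite_norm (le_lt_trans gM) ?ltry.
have f0L1 : f0 \in Lfun (mu01 R) 1 by exact: inL f0k.
have f1p q : 1 <= q -> 'N[mu01 R]_q[EFin \o f1] <= l%:E.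
  by move=> q1; exact: Lnorm_le_bound.
have f1L1 : f1 \in Lfun (mu01 R) 1 by exact: inL (f1p _ (lexx _)).
have f1Lp := inL _ _ _ mf1 (f1p _ (ltW p1)).
have [_ Tf1] := TS _ f1Lp.
have t20 : (0 < t / 2)%R by rewrite divr_gt0.
have t21 : (t / 2 <= 1)%R by lra.
have Tf0E : rearr (T f0) (t / 2) <= ((t / 2)^-1 * (`|W| * k))%:E.
  rewrite EFinM lee_pdivlMl//.
  apply: (@le_trans _ _ (weakL1_norm (T f0))).
    by apply: ereal_sup_ubound; exists (t / 2)%R => //=; rewrite in_itv/= t20.
  rewrite (le_trans (TW _ f0L1))// EFinM.
  apply: (@le_trans _ _ (`|W|%:E * 'N[mu01 R]_1[EFin \o f0])).
    by apply: lee_wpmul2r; [exact: Lnorm_ge0|rewrite lee_fin ler_norm].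
  exact: lee_wpmul2l.
have Tf1E : rearr (T f1) (t / 2) <= ((t / 2)^-1 * (`|S| * k))%:E.
  have Sl : 'N[mu01 R]_p[EFin \o T f1] <= (`|S| * l)%:E.
    rewrite (le_trans Tf1)// EFinM.
    apply: (@le_trans _ _ (`|S|%:E * 'N[mu01 R]_p[EFin \o f1])).
      by apply: lee_wpmul2r; [exact: Lnorm_ge0|rewrite lee_fin ler_norm].
    by apply: lee_wpmul2l => //; apply: f1p; exact: ltW.
  have Sl0 : (0 <= `|S| * l)%R by rewrite mulr_ge0.
  have t201 : (0 < t / 2 <= 1)%R by rewrite t20.
  apply: (le_trans (rearrn _ _ _ (mT _ f1L1) t201 Sl0 Sl)).
  rewrite lee_fin mulrAC mulrC ler_wpM2l ?invr_ge0 ?(ltW t20)//.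
  rewrite mulrCA ler_wpM2l//.
  (* The bound involves the iterated root of [t / 2], which is at most [s]; and [s * l] is K(s). *)
  have -> : k = (s * l)%R by rewrite /l mulrC divfK// gt_eqF.
  rewrite ler_wpM2r// le_iter_sqrt//; lra.
have Qf : \forall x \ae mu01 R, (`|T f x| <= `|Q| * (`|T f0 x| + `|T f1 x|))%R.
  apply: filterS (TQ _ _ f0L1 f1L1) => x; rewrite -fE => /le_trans; apply.
  by rewrite ler_wpM2r ?addr_ge0// ler_norm.
have := rearr_quasilinear (mT _ f0L1) (mT _ f1L1) (mT _ fL1) (normr_ge0 Q)
  _ _ Qf Tf0E Tf1E.
have t2V : (0 <= (t / 2)^-1)%R by rewrite invr_ge0 ltW.
move=> /(_ (mulr_ge0 t2V (mulr_ge0 (normr_ge0 _) k0))).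
move=> /(_ (mulr_ge0 t2V (mulr_ge0 (normr_ge0 _) k0))) Tfle.
have t0E : 0 <= t%:E by rewrite lee_fin ltW.
apply: (le_trans (lee_wpmul2l t0E Tfle)); rewrite -!EFinM lee_fin le_eqVlt.
apply/orP; left; apply/eqP; field; exact: lt0r_neq0.
Qed.

End main.

(** * From the pointwise estimate to the norms of [G] *)

Theorem theorem8 (R : realType) (T : (R -> R) -> R -> R)
    (G : banach_lattice R) :
  operator_on_L1 T ->
  quasilinear_on_L1 T ->
  weak_type_11 T ->
  (exists2 p : \bar R, (1 < p)%E & strong_type T p) ->
  bl_contains_weighted_Linfty G ->
  bl_sqrt_bounded G ->
  bounded_Kspace_Xspace T G.
Proof.
move=> opT qlT wT sT _ sqrtG.
have [n [C C0 TC]] := t_rearr_le_t_rearr_avg_iter_sqrt opT qlT wT sT.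
have [D D0 GD] := bl_iter_sqrt_bounded n sqrtG.
exists (C * D) => f [fL1].
rewrite /bl_enorm; case: asboolP => [[Kfin GK] _|//].
have [GKs Ks] := GD _ GK.
have mTf : measurable_fun setT (T f : measurableTypeR R -> R) := opT.1 _ fL1.
(* The almost everywhere domination that solidity of [G] turns into a norm inequality. *)
have TfK : \forall t \ae mu01 R, t_rearr (T f) t \is a fin_num /\
    `|fine (t_rearr (T f) t)| <=
    `|C * (fine \o t_rearr_avg f) (iter n Num.sqrt t)|.
  apply: filterS (ae_mu01_itvoo R) => t /andP[t0 t1].
  have t01 : 0 < t <= 1 by rewrite t0 ltW.
  have /andP[ts s1] := iter_sqrt_itv n t01.
  have s0 := lt_le_trans t0 ts.
  have {s1}s1 : iter n Num.sqrt t < 1.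
    rewrite lt_neqAle s1 andbT; apply/negP => /eqP s1E.
    by move: t1; rewrite -(iter_sqrtK n (ltW t0)) s1E expr1n ltxx.
  (* K is known to be finite only almost everywhere, while its value at the iterated root s is
     needed. As s < 1, the interval []s, 1[] has positive measure and contains a point where K is
     finite; monotonicity carries this down to s. *)
  have [u [su u1 Ku]] : exists u, [/\ iter n Num.sqrt t < u, u < 1 &
      t_rearr_avg f u \is a fin_num].
    have [N [mN N0 KN]] := Kfin.
    apply: contrapT => noK.
    have : (mu01 R `]iter n Num.sqrt t, 1%R[%classic <= mu01 R N)%E.
      apply: le_measure; rewrite ?inE// => u /=.
      rewrite in_itv/= => /andP[su u1].
      by apply: KN => Ku; apply: noK; exists u.
    rewrite N0 (mu01_itvoo (ltW s0) (ltW s1) (lexx _)) lee_fin subr_le0.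
    by rewrite leNgt s1.
  have Ksfin : t_rearr_avg f (iter n Num.sqrt t) \is a fin_num.
    rewrite ge0_fin_numE ?t_rearr_avg_ge0//.
    rewrite (le_lt_trans (t_rearr_avg_ndecr _ s0 (ltW su)))//.
    by rewrite -ge0_fin_numE// t_rearr_avg_ge0// (lt_trans s0).
  have Tft := TC f t fL1 t01 Ksfin.
  have Tf0 : (0 <= t_rearr (T f) t)%E.
    by rewrite mule_ge0 ?rearr_ge0// lee_fin ltW.
  rewrite -(fineK Ksfin) -EFinM in Tft.
  have Tffin : t_rearr (T f) t \is a fin_num.
    by rewrite ge0_fin_numE// (le_lt_trans Tft) ?ltry.
  split=> //; rewrite ger0_norm ?fine_ge0//.
  by rewrite (le_trans _ (ler_norm _))// -lee_fin fineK.
have GCK := bl_setZ C GKs.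
have [GTf TfCK] : bl_set G (fine \o t_rearr (T f)) /\
    bl_norm G (fine \o t_rearr (T f)) <=
    bl_norm G (fun x => C * (fine \o t_rearr_avg f \o iter n Num.sqrt) x).
  apply: bl_solid => //; first exact: measurable_fine_t_rearr.
  by apply: filterS TfK => t [].
rewrite /Xspace /bl_enorm /= asboolT; last first.
  by split=> //; apply: filterS TfK => t [].
split; first by split=> //; rewrite ltry.
rewrite -EFinM lee_fin (le_trans TfCK)// bl_normZ// ger0_norm// -mulrA.
exact: ler_wpM2l.
Qed.
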